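(* Let $S=\langle a_1,\ldots,a_e\rangle$ be a numerical semigroup with minimal generators $a_1<a_2<\cdots<a_e$ and genus $g$. Then $$a_e\le 2g+1 .$$
   Context: A numerical semigroup is a submonoid $S$ of $(\mathbb{N},+)$ (with $0\in\mathbb{N}$) whose complement in $\mathbb{N}$ is finite. It has a unique finite minimal generating set. Writing $S=\langle a_1,\ldots,a_e\rangle$ with $a_1<\cdots<a_e$ means that $a_1,\ldots,a_e$ are exactly the minimal generators of $S$. The genus $g=g(S)$ is the number of positive integers not in $S$ (the gaps of $S$). *)

(* Defs.v *)
From mathcomp Require Import all_boot finmap.
From mathcomp Require Import classical_sets cardinality.

Set Implicit Arguments.
Unset Strict Implicit.
Unset Printing Implicit Defensive.

Local Open Scope classical_set_scope.
Local Open Scope nat_scope.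

Definition submonoid (S : set nat) : Prop :=
  S 0 /\ (forall x y : nat, S x -> S y -> S (x + y)).

Definition numerical_semigroup (S : set nat) : Prop :=
  submonoid S /\ finite_set (~` S).

Definition gaps (S : set nat) : set nat := [set n | 0 < n /\ ~ S n].

(* [fset_set] returns the empty set on infinite sets, so [genus S] is
   meaningful only when [gaps S] is finite. *)
Definition genus (S : set nat) : nat := #|` fset_set (gaps S)|.

Definition generated (A : set nat) : set nat := smallest submonoid A.

Definition minimal_generating_set (S A : set nat) : Prop :=
  generated A = S /\ (forall B : set nat, B `<=` A -> generated B = S -> B = A).

(* S = <a_1, ..., a_e> with a_1 < ... < a_e the minimal generators of S. *)
Definition minimal_generators (S : set nat) (a : seq nat) : Prop :=
  sorted ltn a /\ minimal_generating_set S [set` a].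

(* Main.v *)
Require Import Defs.
From mathcomp Require Import all_boot finmap.
From mathcomp Require Import classical_sets cardinality.
From mathcomp Require Import boolp zify.

(** Let [m] be a minimal generator.  It is not a sum of two nonzero elements
    of [S] ([minimal_generator_irreducible]): otherwise the generators other
    than [m] would already produce both summands, hence [m], hence all of [S].
    So for each [x] with [0 < x < m], one of [x] and [m - x] is a gap.
    The [m - 1] integers between [0] and [m] are thus covered by the gaps and
    their reflections through [x |-> m - x], two families of size at most [g],
    so [m - 1 <= 2 * g] ([irreducible_le_genus]).  This bounds every minimal
    generator, and in particular the largest. *)

Local Open Scope classical_set_scope.
Local Open Scope nat_scope.

Lemma submonoid_generated (A : set nat) : submonoid (generated A).
Proof.
split=> [T [[T0 _] _] //|x y Ax Ay T TA].
by case: (TA) => -[_ TD] _; apply: TD; [exact: Ax | exact: Ay].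
Qed.

Lemma sub_generated (A : set nat) : A `<=` generated A.
Proof. by move=> x Ax T [_]; apply. Qed.

Lemma generated_sub (A T : set nat) :
  submonoid T -> A `<=` T -> generated A `<=` T.
Proof. by move=> monT AT x; apply. Qed.

(** A sum of nonnegative integers equal to [x < m] cannot use a summand [m]. *)
Lemma generated_setD1_lt (A : set nat) (m x : nat) :
  generated A x -> x < m -> generated (A `\ m) x.
Proof.
set gen := generated (A `\ m) => Ax ltxm.
have [gen0 genD] : submonoid gen by exact: submonoid_generated.
(* Adjoining all integers from [m] on to the submonoid generated by [A `\ m]
   gives a submonoid containing [A], which is unchanged below [m]. *)
suff : gen x \/ m <= x by case=> //; lia.
apply: (@generated_sub A (fun n => gen n \/ m <= n)) Ax.
  split=> [|u v]; first by left.
  by move=> [gu|mu] [gv|mv]; first (by left; apply: genD); right; lia.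
move=> n An; have [->|/eqP nm] := eqVneq n m; first by right.
by left; apply: sub_generated.
Qed.

Lemma minimal_generator_irreducible (S A : set nat) (m x y : nat) :
  minimal_generating_set S A -> A m -> S x -> S y -> 0 < x -> 0 < y ->
  x + y <> m.
Proof.
move=> [<- minA] Am Sx Sy x0 y0 xym.
have [_ genD] := submonoid_generated (A `\ m).
have genm : generated (A `\ m) m.
  by rewrite -[X in generated _ X]xym; apply: genD;
    apply: generated_setD1_lt => //; lia.
have Dm : A `\ m = A.
  apply: minA; first by move=> n [].
  apply/seteqP; split; apply: generated_sub; try exact: submonoid_generated.
    by move=> n [An _]; apply: sub_generated.
  move=> n An; have [->//|/eqP nm] := eqVneq n m.
  by apply: sub_generated.
by move: Am; rewrite -Dm => -[_]; apply.
Qed.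

Lemma irreducible_le_genus (S : set nat) (m : nat) :
  finite_set (gaps S) ->
  (forall x y, S x -> S y -> 0 < x -> 0 < y -> x + y <> m) ->
  m <= 2 * genus S + 1.
Proof.
move=> finG irr; pose G : seq nat := fset_set (gaps S).
have inG x : 0 < x -> ~ S x -> x \in G.
  by move=> x0 Sx; rewrite /G in_fset_set // inE.
suff : size (iota 1 m.-1) <= size (G ++ [seq m - x | x <- G]).
  by rewrite size_iota size_cat size_map -[size G]/(genus S); lia.
apply: uniq_leq_size; first exact: iota_uniq.
move=> x; rewrite mem_iota mem_cat => /andP[x0 xm].
have [Sx|Sx] := pselect (S x); last by rewrite inG.
apply/orP; right; apply/mapP; exists (m - x); last by lia.
apply: inG => [|Smx]; first by lia.
by apply: (irr x (m - x)) => //; lia.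
Qed.

Theorem lemma2p1 (S : set nat) (e : nat) (a : e.-tuple nat)
    (hS : numerical_semigroup S) (ha : minimal_generators S a) :
  last 0 a <= 2 * genus S + 1.
Proof.
case: hS => _ finC; case: ha => _ minA.
have finG : finite_set (gaps S).
  by apply: sub_finite_set finC => n [].
have : last 0 a \in 0 :: a by exact: mem_last.
rewrite inE => /predU1P[->//|am].
apply: irreducible_le_genus => // x y.
exact: minimal_generator_irreducible minA am.
Qed.
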